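(* Let $\mathfrak{g}, \mathfrak{h}$ be two Leibniz algebras, let $\mathfrak{h}$ be a Leibniz $\mathfrak{g}$-representation, let $T: \mathfrak{h} \rightarrow \mathfrak{g}$ be a $\lambda$-weighted relative Rota-Baxter operator, and let $T_t^N = \sum_{i=0}^N t^i T_i$ be an order $N$ deformation of $T$. Then $T^N_t$ is extensible if and only if the corresponding obstruction class $[Ob_{T^N_t}] \in H^2_{\mathrm{Leib}}(\mathfrak{h}_T,\mathfrak{g})$ vanishes.
   Context: All vector spaces and (multi)linear maps are over a field $\mathbf{k}$ of characteristic $0$, and $\lambda \in \mathbf{k}$ is a fixed scalar. A (left) Leibniz algebra is a vector space $\mathfrak{g}$ with a bilinear bracket $[~,~]_\mathfrak{g}$ satisfying $[x,[y,z]_\mathfrak{g}]_\mathfrak{g} = [[x,y]_\mathfrak{g},z]_\mathfrak{g} + [y,[x,z]_\mathfrak{g}]_\mathfrak{g}$ for all $x,y,z$. A representation of $\mathfrak{g}$ is a vector space $V$ with bilinear maps $\rho^L : \mathfrak{g}\otimes V \to V$, $\rho^R : V \otimes \mathfrak{g} \to V$ such that for $x,y\in\mathfrak{g}$, $v \in V$: $\rho^L(x,\rho^L(y,v)) = \rho^L([x,y]_\mathfrak{g},v) + \rho^L(y,\rho^L(x,v))$; $\rho^L(x,\rho^R(v,y)) = \rho^R(\rho^L(x,v),y) + \rho^R(v,[x,y]_\mathfrak{g})$; $\rho^R(v,[x,y]_\mathfrak{g}) = \rho^R(\rho^R(v,x),y) + \rho^L(x,\rho^R(v,y))$. A Leibniz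 algebra $\mathfrak{h}$ is a Leibniz $\mathfrak{g}$-representation if it has maps $\rho^L,\rho^R$ making it a representation of $\mathfrak{g}$ and, for $u,v\in\mathfrak{h}$, $x\in\mathfrak{g}$: $[u,\rho^R(v,x)]_\mathfrak{h} = \rho^R([u,v]_\mathfrak{h},x) + [v,\rho^R(u,x)]_\mathfrak{h}$; $[u,\rho^L(x,v)]_\mathfrak{h} = [\rho^R(u,x),v]_\mathfrak{h} + \rho^L(x,[u,v]_\mathfrak{h})$; $\rho^L(x,[u,v]_\mathfrak{h}) = [\rho^L(x,u),v]_\mathfrak{h} + [u,\rho^L(x,v)]_\mathfrak{h}$. A linear map $T:\mathfrak{h}\to\mathfrak{g}$ is a $\lambda$-weighted relative Rota-Baxter operator if $[Tu,Tv]_\mathfrak{g} = T(\rho^L(Tu,v)+\rho^R(u,Tv)+\lambda[u,v]_\mathfrak{h})$ for all $u,v\in\mathfrak{h}$. Cohomology complex of $T$: let $\mathfrak{h}_T$ be the Leibniz algebra $\mathfrak{h}$ with bracket $[u,v]_T = \rho^L(Tu,v)+\rho^R(u,Tv)+\lambda[u,v]_\mathfrak{h}$; it has a representation on $\mathfrak{g}$ given by $\varrho^L(u,x)=[Tu,x]_\mathfrak{g}-T(\rho^R(u,x))$, $\varrho^R(x,u)=[x,Tu]_\mathfrak{g}-T(\rho^L(x,u))$. The cochain groups are $\mathrm{Hom}(\mathfrak{h}^{\otimes n},\mathfrak{g})$, $n\ge 0$, with differential $$(\delta_{\mathrm{Leib}}f)(u_1,\ldots,u_{n+1}) = \sum_{i=1}^n(-1)^{i+1}\varrho^L(u_i,f(u_1,\ldots,\widehat{u_i},\ldots,u_{n+1}))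 + (-1)^{n+1}\varrho^R(f(u_1,\ldots,u_n),u_{n+1}) + \sum_{1\le i<j\le n+1}(-1)^i f(u_1,\ldots,\widehat{u_i},\ldots,u_{j-1},[u_i,u_j]_T,u_{j+1},\ldots,u_{n+1}).$$ Its cohomology groups are denoted $H^n_{\mathrm{Leib}}(\mathfrak{h}_T,\mathfrak{g})$. For $P,Q\in\mathrm{Hom}(\mathfrak{h},\mathfrak{g})$ define $\llbracket P,Q\rrbracket\in\mathrm{Hom}(\mathfrak{h}^{\otimes2},\mathfrak{g})$ by $$\llbracket P,Q\rrbracket(u,v) = P(\rho^L(Qu,v)+\rho^R(u,Qv)) + Q(\rho^L(Pu,v)+\rho^R(u,Pv)) - [Pu,Qv]_\mathfrak{g}-[Qu,Pv]_\mathfrak{g}.$$ Finite order deformations: fix $N\in\mathbb{N}$. The Leibniz structures and actions extend $\mathbf{k}[[t]]/(t^{N+1})$-bilinearly to $\mathfrak{g}[[t]]/(t^{N+1})$ and $\mathfrak{h}[[t]]/(t^{N+1})$. An order $N$ deformation of $T$ is $T_t^N=\sum_{i=0}^Nt^iT_i\in\mathrm{Hom}(\mathfrak{h},\mathfrak{g})[[t]]/(t^{N+1})$ with $T_0=T$ such that the $\mathbf{k}[[t]]/(t^{N+1})$-linear map $T_t^N:\mathfrak{h}[[t]]/(t^{N+1})\to\mathfrak{g}[[t]]/(t^{N+1})$ is a $\lambda$-weighted relative Rota-Baxter operator. It is extensible if there is a linear map $T_{N+1}:\mathfrak{h}\to\mathfrak{g}$ such that $T_t^N+t^{N+1}T_{N+1}$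 is an order $N+1$ deformation of $T$. The obstruction cochain is $Ob_{T_t^N} = -\frac12\sum_{i+j=N+1,\ i,j\ge1}\llbracket T_i,T_j\rrbracket\in\mathrm{Hom}(\mathfrak{h}^{\otimes 2},\mathfrak{g})$; it is a $2$-cocycle in the cohomology complex of $T$, and its class $[Ob_{T_t^N}]$ is the obstruction class. *)

(* Defs.v *)
From HB Require Import structures.
From mathcomp Require Import all_boot all_algebra.
From mathcomp Require Import sesquilinear ring_quotient generic_quotient.
From mathcomp Require Import boolp functions.

Set Implicit Arguments.
Unset Strict Implicit.
Unset Printing Implicit Defensive.

Import GRing.Theory.
Local Open Scope ring_scope.

(* V[[t]]/(t^{N+1}); x i is the coefficient of t^i. *)
Definition tser (N : nat) (V : Type) := {ffun 'I_N.+1 -> V}.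

HB.instance Definition _ N (V : zmodType) := GRing.Zmodule.on (tser N V).

Section TruncatedSeries.
Variable N : nat.

(* n-th coefficient: \sum_{i+j=n} F i j. *)
Definition cauchy (V : zmodType) (F : 'I_N.+1 -> 'I_N.+1 -> V) : tser N V :=
  [ffun n : 'I_N.+1 => \sum_(i < N.+1) \sum_(j < N.+1 | (i + j == n)%N) F i j].

(* The k[[t]]/(t^{N+1})-bilinear extension of B. *)
Definition tmap2 (U V W : zmodType) (B : U -> V -> W)
    (x : tser N U) (y : tser N V) : tser N W :=
  cauchy (fun i j => B (x i) (y j)).

Definition tconst (V : zmodType) (v : V) : tser N V :=
  [ffun i => if i == 0 then v else 0].

Section Cauchy.
Variable V : zmodType.

Lemma eq_cauchy (F G : 'I_N.+1 -> 'I_N.+1 -> V) :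
  (forall i j, F i j = G i j) -> cauchy F = cauchy G.
Proof.
by move=> e; apply/ffunP => n; rewrite !ffunE; do 2!apply: eq_bigr => ? _.
Qed.

Lemma cauchyC (F : 'I_N.+1 -> 'I_N.+1 -> V) :
  cauchy F = cauchy (fun i j => F j i).
Proof.
apply/ffunP => n; rewrite !ffunE (exchange_big_dep xpredT) //=.
by apply: eq_bigr => j _; apply: eq_bigl => i; rewrite addnC.
Qed.

Lemma cauchyD (F G : 'I_N.+1 -> 'I_N.+1 -> V) :
  cauchy (fun i j => F i j + G i j) = cauchy F + cauchy G.
Proof.
apply/ffunP => n; rewrite !ffunE -big_split.
by apply: eq_bigr => i _; rewrite big_split.
Qed.

Lemma cauchy0 (F : 'I_N.+1 -> 'I_N.+1 -> V) : cauchy F 0 = F 0 0.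
Proof.
rewrite ffunE (bigD1 0) //= (bigD1 0) //= !big1 ?addr0 //.
  move=> i i0; rewrite big1 // => j /eqP e; case/eqP: i0.
  by apply/val_inj => /=; case: (val i) e.
by move=> j /andP[/eqP e]; case/eqP; apply/val_inj.
Qed.

Lemma cauchy_const_l (F : 'I_N.+1 -> 'I_N.+1 -> V) n :
  (forall i j, i != 0 -> F i j = 0) -> cauchy F n = F 0 n.
Proof.
move=> F0; rewrite ffunE (bigD1 0) //= addrC big1 ?add0r => [|i i0].
  by rewrite (big_pred1 n).
by rewrite big1 // => j _; apply: F0.
Qed.

Definition cauchy3 (F : 'I_N.+1 -> 'I_N.+1 -> 'I_N.+1 -> V) : tser N V :=
  [ffun n : 'I_N.+1 => \sum_(i < N.+1) \sum_(j < N.+1)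
    \sum_(k < N.+1 | (i + j + k == n)%N) F i j k].

Lemma cauchyAl (F : 'I_N.+1 -> 'I_N.+1 -> 'I_N.+1 -> V) :
  cauchy (fun m k => cauchy (fun i j => F i j k) m) = cauchy3 F.
Proof.
apply/ffunP => n; rewrite !ffunE.
have -> : \sum_(m < N.+1) \sum_(k < N.+1 | (m + k == n)%N) cauchy (fun i j => F i j k) m
  = \sum_(i < N.+1) \sum_(j < N.+1) \sum_(m < N.+1)
      \sum_(k < N.+1 | (m + k == n)%N && (i + j == m)%N) F i j k.
  transitivity (\sum_(m < N.+1) \sum_(i < N.+1) \sum_(j < N.+1)
      \sum_(k < N.+1 | (m + k == n)%N && (i + j == m)%N) F i j k).
    apply: eq_bigr => m _.
    under eq_bigr do rewrite ffunE.
    rewrite (exchange_big_dep xpredT) //=; apply: eq_bigr => i _.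
    rewrite (exchange_big_dep xpredT) //=; apply: eq_bigr => j _.
    by apply: eq_bigl => k; rewrite andbT.
  by rewrite exchange_big; apply: eq_bigr => i _; rewrite exchange_big.
apply: eq_bigr => i _; apply: eq_bigr => j _.
rewrite (exchange_big_dep (fun k : 'I_N.+1 => (i + j + k)%N == n)) /=; last first.
  by move=> m k _ /andP[/eqP <- /eqP ->].
apply: eq_bigr => k /eqP e.
have lt : (i + j < N.+1)%N.
  by apply: leq_ltn_trans (ltn_ord n); rewrite -e leq_addr.
rewrite (big_pred1 (Ordinal lt)) // => m /=.
apply/andP/eqP => [[_ /eqP h]|->]; first by apply/val_inj.
by rewrite /= e !eqxx.
Qed.

Lemma cauchy3_swap (F : 'I_N.+1 -> 'I_N.+1 -> 'I_N.+1 -> V) :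
  cauchy3 F = cauchy3 (fun i j k => F j i k).
Proof.
apply/ffunP => n; rewrite !ffunE exchange_big; apply: eq_bigr => i _.
by apply: eq_bigr => j _; apply: eq_bigl => k; rewrite [(j + i)%N]addnC.
Qed.

Lemma cauchyAr (F : 'I_N.+1 -> 'I_N.+1 -> 'I_N.+1 -> V) :
  cauchy (fun i m => cauchy (fun j k => F i j k) m) = cauchy3 F.
Proof.
rewrite cauchyC (cauchyAl (fun j k i => F i j k)).
rewrite [RHS]cauchy3_swap; apply/ffunP => n; rewrite !ffunE.
apply: eq_bigr => j _; rewrite (exchange_big_dep xpredT) //=.
by apply: eq_bigr => i _; apply: eq_bigl => k; rewrite addnAC.
Qed.

End Cauchy.

Section Ring.
Variable R : comNzRingType.
Let mul : tser N R -> tser N R -> tser N R := tmap2 *%R.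
Let one : tser N R := tconst 1.

Let mulA : associative mul.
Proof.
move=> x y z; rewrite /mul /tmap2.
under [LHS]eq_cauchy => i m do rewrite !ffunE mulr_sumr.
transitivity (cauchy3 (fun i j k => x i * y j * z k)).
  rewrite -cauchyAr; apply: eq_cauchy => i m; rewrite ffunE.
  apply: eq_bigr => j _; rewrite mulr_sumr; apply: eq_bigr => k _.
  by rewrite mulrA.
rewrite -cauchyAl; apply: eq_cauchy => m k; rewrite !ffunE mulr_suml.
by apply: eq_bigr => j _; rewrite mulr_suml.
Qed.

Let mulC : commutative mul.
Proof. by move=> x y; rewrite /mul /tmap2 cauchyC; apply: eq_cauchy => i j; rewrite mulrC. Qed.

Let mul1 : left_id one mul.
Proof.
move=> x; apply/ffunP => n; rewrite cauchy_const_l ?ffunE ?mul1r //.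
by move=> i j /negPf i0; rewrite ffunE i0 mul0r.
Qed.

Let mulDl : left_distributive mul +%R.
Proof.
move=> x y z; rewrite /mul /tmap2 -cauchyD; apply: eq_cauchy => i j.
by rewrite ffunE mulrDl.
Qed.

Let one_neq0 : one != 0.
Proof.
by apply/eqP => /ffunP/(_ 0)/eqP; rewrite !ffunE /= oner_eq0.
Qed.

HB.instance Definition _ :=
  GRing.Zmodule_isComNzRing.Build (tser N R) mulA mulC mul1 mulDl one_neq0.

Lemma tser_mulE (a b : tser N R) : a * b = tmap2 *%R a b.
Proof. by []. Qed.

Lemma tser_oneE : 1 = tconst 1 :> tser N R.
Proof. by []. Qed.

Variable V : lmodType R.
Let scale : tser N R -> tser N V -> tser N V := tmap2 *:%R.

Let scaleA a b v : scale a (scale b v) = scale (a * b) v.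
Proof.
transitivity (cauchy3 (fun i j k => (a i * b j) *: v k)).
  rewrite -cauchyAr; apply: eq_cauchy => i m; rewrite !ffunE scaler_sumr.
  apply: eq_bigr => j _; rewrite scaler_sumr; apply: eq_bigr => k _.
  by rewrite scalerA.
rewrite -cauchyAl; apply: eq_cauchy => m k; rewrite !ffunE scaler_suml.
by apply: eq_bigr => j _; rewrite scaler_suml.
Qed.

Let scale1 : left_id 1 scale.
Proof.
move=> x; apply/ffunP => n; rewrite cauchy_const_l ?ffunE ?scale1r //.
by move=> i j /negPf i0; rewrite ffunE i0 scale0r.
Qed.

Let scaleDr : right_distributive scale +%R.
Proof.
move=> a x y; rewrite /scale /tmap2 -cauchyD; apply: eq_cauchy => i j.
by rewrite ffunE scalerDr.
Qed.

Let scaleDl v : {morph scale^~ v : a b / a + b}.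
Proof.
move=> a b; rewrite /scale /tmap2 -cauchyD; apply: eq_cauchy => i j.
by rewrite ffunE scalerDl.
Qed.

HB.instance Definition _ :=
  GRing.Zmodule_isLmodule.Build (tser N R) (tser N V)
    scaleA scale1 scaleDr scaleDl.

Lemma tser_scaleE (a : tser N R) (x : tser N V) : a *: x = tmap2 *:%R a x.
Proof. by []. Qed.

End Ring.

Section Bilinear.
Variables (R : comNzRingType) (U V W : lmodType R).

Lemma tmap2_bilinear (B : {bilinear U -> V -> W}) :
  bilinear_for *:%R *:%R (tmap2 B : tser N U -> tser N V -> tser N W).
Proof.
split=> [y a x x'|x a y y']; rewrite !tser_scaleE.
  have -> : tmap2 B (tmap2 *:%R a x + x') y
            = tmap2 B (tmap2 *:%R a x) y + tmap2 B x' y.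
    by rewrite -cauchyD; apply: eq_cauchy => i j; rewrite !ffunE linearDl.
  congr (_ + _); transitivity (cauchy3 (fun i j k => a i *: B (x j) (y k))).
    rewrite -cauchyAl; apply: eq_cauchy => m k; rewrite !ffunE linear_sumlz.
    apply: eq_bigr => i _; rewrite linear_sumlz; apply: eq_bigr => j _.
    by rewrite linearZl_LR.
  rewrite -cauchyAr; apply: eq_cauchy => i m; rewrite !ffunE scaler_sumr.
  by apply: eq_bigr => j _; rewrite scaler_sumr.
have -> : tmap2 B x (tmap2 *:%R a y + y')
          = tmap2 B x (tmap2 *:%R a y) + tmap2 B x y'.
  by rewrite -cauchyD; apply: eq_cauchy => i j; rewrite !ffunE linearDr.
congr (_ + _); transitivity (cauchy3 (fun i j k => a j *: B (x i) (y k))).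
  rewrite -cauchyAr; apply: eq_cauchy => i m; rewrite !ffunE linear_sumr.
  apply: eq_bigr => j _; rewrite linear_sumr; apply: eq_bigr => k _.
  by rewrite linearZr_LR.
rewrite cauchy3_swap -cauchyAr; apply: eq_cauchy => i m.
rewrite !ffunE scaler_sumr.
by apply: eq_bigr => j _; rewrite scaler_sumr.
Qed.

HB.instance Definition _ (B : {bilinear U -> V -> W}) :=
  bilinear_isBilinear.Build (tser N R) (tser N U) (tser N V) (tser N W)
    *:%R *:%R (tmap2 B) (tmap2_bilinear B).

(* The k[[t]]/(t^{N+1})-linear map \sum_i t^i Ts_i. *)
Definition tmap (Ts : 'I_N.+1 -> {linear U -> V}) (x : tser N U) : tser N V :=
  cauchy (fun i j => Ts i (x j)).

Lemma tmap_linear Ts : linear (tmap Ts).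
Proof.
move=> a x x'; rewrite tser_scaleE.
have -> : tmap Ts (tmap2 *:%R a x + x')
          = tmap Ts (tmap2 *:%R a x) + tmap Ts x'.
  by rewrite -cauchyD; apply: eq_cauchy => i j; rewrite !ffunE linearD.
congr (_ + _); transitivity (cauchy3 (fun i j k => a j *: Ts i (x k))).
  rewrite -cauchyAr; apply: eq_cauchy => i m; rewrite !ffunE linear_sum.
  apply: eq_bigr => j _; rewrite linear_sum; apply: eq_bigr => k _.
  by rewrite linearZ.
rewrite tser_scaleE cauchy3_swap -cauchyAr; apply: eq_cauchy => i m.
rewrite !ffunE scaler_sumr.
by apply: eq_bigr => j _; rewrite scaler_sumr.
Qed.

HB.instance Definition _ Ts :=
  GRing.isLinear.Build (tser N R) (tser N U) (tser N V) *:%R (tmap Ts)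
    (tmap_linear Ts).

End Bilinear.

End TruncatedSeries.

HB.mixin Record isLeibniz (R : comNzRingType) (g : Type) of GRing.Lmodule R g
  := {
  lbr : {bilinear g -> g -> g};
  lbr_leibniz : forall x y z : g,
    lbr x (lbr y z) = lbr (lbr x y) z + lbr y (lbr x z)
}.

#[short(type="leibnizType")]
HB.structure Definition Leibniz (R : comNzRingType) :=
  {g of isLeibniz R g & GRing.Lmodule R g}.

Record leibniz_rep (R : comNzRingType) (g : leibnizType R) (V : lmodType R) :=
  LeibnizRep {
    rhoL : {bilinear g -> V -> V};
    rhoR : {bilinear V -> g -> V};
    rhoLL : forall x y v,
      rhoL x (rhoL y v) = rhoL (lbr x y) v + rhoL y (rhoL x v);
    rhoLR : forall x v y,
      rhoL x (rhoR v y) = rhoR (rhoL x v) y + rhoR v (lbr x y);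
    rhoRR : forall v x y,
      rhoR v (lbr x y) = rhoR (rhoR v x) y + rhoL x (rhoR v y)
  }.

Record leibniz_alg_rep (R : comNzRingType) (g h : leibnizType R) :=
  LeibnizAlgRep {
    alg_rep :> leibniz_rep g h;
    lbr_rhoR : forall u v x,
      lbr u (rhoR alg_rep v x)
      = rhoR alg_rep (lbr u v) x + lbr v (rhoR alg_rep u x);
    lbr_rhoL : forall u x v,
      lbr u (rhoL alg_rep x v)
      = lbr (rhoR alg_rep u x) v + rhoL alg_rep x (lbr u v);
    rhoL_lbr : forall x u v,
      rhoL alg_rep x (lbr u v)
      = lbr (rhoL alg_rep x u) v + lbr u (rhoL alg_rep x v)
  }.

Definition is_rrb (R : comNzRingType) (lambda : R) (g h : leibnizType R)
    (rho : leibniz_alg_rep g h) (T : {linear h -> g}) : Prop :=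
  forall u v : h,
    lbr (T u) (T v)
    = T (rhoL rho (T u) v + rhoR rho u (T v) + lambda *: lbr u v).

Section Extension.
Variables (N : nat) (R : comNzRingType).

Section Nest.
Variables (U V W X Y : lmodType R).
Variables (x : tser N U) (y : tser N V) (z : tser N W).

Lemma tmap2_nestr (B : {bilinear U -> X -> Y}) (C : {bilinear V -> W -> X}) :
  tmap2 B x (tmap2 C y z) = cauchy3 (fun i j k => B (x i) (C (y j) (z k))).
Proof.
rewrite -cauchyAr; apply: eq_cauchy => i m; rewrite !ffunE linear_sumr.
by apply: eq_bigr => j _; rewrite linear_sumr.
Qed.

Lemma tmap2_nestl (B : {bilinear X -> W -> Y}) (C : {bilinear U -> V -> X}) :
  tmap2 B (tmap2 C x y) z = cauchy3 (fun i j k => B (C (x i) (y j)) (z k)).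
Proof.
rewrite -cauchyAl; apply: eq_cauchy => m k; rewrite !ffunE linear_sumlz.
by apply: eq_bigr => j _; rewrite linear_sumlz.
Qed.

End Nest.

Lemma cauchy3D (V : zmodType) (F G : 'I_N.+1 -> 'I_N.+1 -> 'I_N.+1 -> V) :
  cauchy3 (fun i j k => F i j k + G i j k) = cauchy3 F + cauchy3 G.
Proof.
apply/ffunP => n; rewrite !ffunE -big_split; apply: eq_bigr => i _.
by rewrite -big_split; apply: eq_bigr => j _; rewrite big_split.
Qed.

Lemma eq_cauchy3 (V : zmodType) (F G : 'I_N.+1 -> 'I_N.+1 -> 'I_N.+1 -> V) :
  (forall i j k, F i j k = G i j k) -> cauchy3 F = cauchy3 G.
Proof.
by move=> e; apply/ffunP => n; rewrite !ffunE; do 3!apply: eq_bigr => ? _.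
Qed.

Section LeibnizExtension.
Variable g : leibnizType R.

Let tlbr : {bilinear tser N g -> tser N g -> tser N g} := tmap2 (@lbr R g).

Let tlbr_leibniz x y z : tlbr x (tlbr y z) = tlbr (tlbr x y) z + tlbr y (tlbr x z).
Proof.
rewrite /= !tmap2_nestr tmap2_nestl [X in _ = _ + X]cauchy3_swap -cauchy3D.
by apply: eq_cauchy3 => i j k; apply: lbr_leibniz.
Qed.

HB.instance Definition _ := isLeibniz.Build (tser N R) (tser N g) tlbr_leibniz.

Lemma tser_lbrE (x y : tser N g) : lbr x y = tmap2 (@lbr R g) x y.
Proof. by []. Qed.

End LeibnizExtension.

Section RepExtension.
Variables (g h : leibnizType R) (rho : leibniz_alg_rep g h).

Let trhoL : {bilinear tser N g -> tser N h -> tser N h} := tmap2 (rhoL rho).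
Let trhoR : {bilinear tser N h -> tser N g -> tser N h} := tmap2 (rhoR rho).

Let trhoLL x y v : trhoL x (trhoL y v) = trhoL (lbr x y) v + trhoL y (trhoL x v).
Proof.
rewrite tser_lbrE /= !tmap2_nestr tmap2_nestl [X in _ = _ + X]cauchy3_swap.
by rewrite -cauchy3D; apply: eq_cauchy3 => i j k; apply: rhoLL.
Qed.

Let trhoLR x v y : trhoL x (trhoR v y) = trhoR (trhoL x v) y + trhoR v (lbr x y).
Proof.
rewrite tser_lbrE /= !tmap2_nestr tmap2_nestl [X in _ = _ + X]cauchy3_swap.
by rewrite -cauchy3D; apply: eq_cauchy3 => i j k; apply: rhoLR.
Qed.

Let trhoRR v x y : trhoR v (lbr x y) = trhoR (trhoR v x) y + trhoL x (trhoR v y).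
Proof.
rewrite tser_lbrE /= !tmap2_nestr tmap2_nestl [X in _ = _ + X]cauchy3_swap.
by rewrite -cauchy3D; apply: eq_cauchy3 => i j k; apply: rhoRR.
Qed.

Definition trep0 : leibniz_rep (tser N g) (tser N h) :=
  LeibnizRep trhoLL trhoLR trhoRR.

Let tlbr_rhoR u v x :
  lbr u (rhoR trep0 v x) = rhoR trep0 (lbr u v) x + lbr v (rhoR trep0 u x).
Proof.
rewrite !tser_lbrE /= !tmap2_nestr tmap2_nestl [X in _ = _ + X]cauchy3_swap.
by rewrite -cauchy3D; apply: eq_cauchy3 => i j k; apply: lbr_rhoR.
Qed.

Let tlbr_rhoL u x v :
  lbr u (rhoL trep0 x v) = lbr (rhoR trep0 u x) v + rhoL trep0 x (lbr u v).
Proof.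
rewrite !tser_lbrE /= !tmap2_nestr tmap2_nestl [X in _ = _ + X]cauchy3_swap.
by rewrite -cauchy3D; apply: eq_cauchy3 => i j k; apply: lbr_rhoL.
Qed.

Let trhoL_lbr x u v :
  rhoL trep0 x (lbr u v) = lbr (rhoL trep0 x u) v + lbr u (rhoL trep0 x v).
Proof.
rewrite !tser_lbrE /= !tmap2_nestr tmap2_nestl [X in _ = _ + X]cauchy3_swap.
by rewrite -cauchy3D; apply: eq_cauchy3 => i j k; apply: rhoL_lbr.
Qed.

Definition trep : leibniz_alg_rep (tser N g) (tser N h) :=
  LeibnizAlgRep tlbr_rhoR tlbr_rhoL trhoL_lbr.

End RepExtension.
End Extension.

Section Complex.
Variables (R : comNzRingType) (lambda : R) (g h : leibnizType R).
Variables (rho : leibniz_alg_rep g h) (T : {linear h -> g}).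

Definition brT (u v : h) : h :=
  rhoL rho (T u) v + rhoR rho u (T v) + lambda *: lbr u v.

(* The representation of h_T = (h, brT) on g. *)
Definition varrhoL (u : h) (x : g) : g := lbr (T u) x - T (rhoR rho u x).

Definition varrhoR (x : g) (u : h) : g := lbr x (T u) - T (rhoL rho x u).

(* Arbitrary maps; membership in Hom(h^{\otimes n}, g) is [multilinear]. *)
Definition cochain (n : nat) := {ffun 'I_n -> h} -> g.

HB.instance Definition _ n := GRing.Zmodule.on (cochain n).

(* u with its i-th entry replaced by x *)
Definition subst n (u : {ffun 'I_n -> h}) (i : 'I_n) (x : h) : {ffun 'I_n -> h} :=
  [ffun j => if j == i then x else u j].

(* u with its i-th entry removed *)
Definition omit n (i : 'I_n.+1) (u : {ffun 'I_n.+1 -> h}) : {ffun 'I_n -> h} :=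
  [ffun j => u (lift i j)].

Definition multilinear n (f : cochain n) : Prop :=
  forall (u : {ffun 'I_n -> h}) (i : 'I_n), linear (fun x => f (subst u i x)).

(* Indices start at 0, whence the shift in the exponents of the signs. *)
Definition delta n (f : cochain n) : cochain n.+1 := fun u =>
  \sum_(i < n)
     (-1) ^+ i *: varrhoL (u (widen_ord (leqnSn n) i))
                          (f (omit (widen_ord (leqnSn n) i) u))
  + (-1) ^+ n.+1 *: varrhoR (f (omit ord_max u)) (u ord_max)
  + \sum_(i < n.+1) \sum_(j < n.+1 | (i < j)%N)
      (-1) ^+ i.+1 *: f (omit i (subst u j (brT (u i) (u j)))).

Lemma varrhoLD u : {morph varrhoL u : x y / x + y}.
Proof. by move=> x y; rewrite /varrhoL linearDr (linearDr (rhoR rho)) raddfD opprD addrACA. Qed.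

Lemma varrhoRD u : {morph varrhoR^~ u : x y / x + y}.
Proof. by move=> x y; rewrite /varrhoR linearDl (linearDl (rhoL rho)) raddfD opprD addrACA. Qed.

Lemma deltaD n : {morph @delta n : f f' / f + f'}.
Proof.
move=> f f'; apply/funext => u; rewrite /delta.
under eq_bigr do rewrite varrhoLD scalerDr.
rewrite varrhoRD scalerDr.
under [X in _ + X = _]eq_bigr do
  (under eq_bigr do rewrite scalerDr; rewrite big_split).
by rewrite !big_split /= [X in X + _ = _]addrACA [LHS]addrACA.
Qed.

Lemma delta0 n : delta (0 : cochain n) = 0.
Proof. by apply: (addrI (delta 0)); rewrite -deltaD !addr0. Qed.

Lemma deltaB n : {morph @delta n : f f' / f - f'}.
Proof.
by move=> f f'; apply: (addIr (delta f')); rewrite -deltaD !subrK.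
Qed.

Lemma multilinear0 n : multilinear (0 : cochain n).
Proof. by move=> u i a x y; rewrite scaler0 addr0. Qed.

Lemma multilinearB n (f f' : cochain n) :
  multilinear f -> multilinear f' -> multilinear (f - f').
Proof.
move=> mf mf' u i a x y.
by rewrite -[LHS]/(f _ - f' _) mf mf' scalerBr opprD addrACA.
Qed.

Definition is_cocycle n : {pred cochain n} :=
  fun f => `[< multilinear f /\ delta f = 0 >].

Lemma is_cocycle_closed n : zmod_closed (@is_cocycle n).
Proof.
split=> [|f f' /asboolP[mf df] /asboolP[mf' df']]; apply/asboolP.
  by split; [exact: multilinear0 | exact: delta0].
by split; [exact: multilinearB | rewrite deltaB df df' subr0].
Qed.

HB.instance Definition _ n :=
  GRing.isZmodClosed.Build (cochain n) (@is_cocycle n) (@is_cocycle_closed n).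

Record cocycle (n : nat) := Cocycle {
  cocycle_val :> cochain n;
  cocycleP : cocycle_val \in @is_cocycle n
}.

HB.instance Definition _ n := [isSub for @cocycle_val n].
HB.instance Definition _ n := [Choice of cocycle n by <:].
HB.instance Definition _ n := [SubChoice_isSubZmodule of cocycle n by <:].

(* H^n is the group of cocycles modulo those cocycles that are coboundaries;
   H^0 is the group of 0-cocycles. *)
Definition coboundary n : cochain n -> Prop :=
  match n with
  | 0 => fun f => f = 0
  | m.+1 => fun f => exists2 b : cochain m, multilinear b & f = delta b
  end.

Definition is_coboundary n : {pred cocycle n} :=
  fun z => `[< coboundary (cocycle_val z) >].

Lemma is_coboundary_closed n : zmod_closed (@is_coboundary n).
Proof.
case: n => [|n]; (split=> [|z z' /asboolP + /asboolP +]; first apply/asboolP) => /=.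
- by [].
- by move=> z0 z'0; apply/asboolP; rewrite /= z0 z'0 subr0.
- by exists 0; [exact: multilinear0 | rewrite delta0].
- move=> [b mb e] [b' mb' e']; apply/asboolP; exists (b - b').
    exact: multilinearB.
  by rewrite deltaB /= e e'.
Qed.

HB.instance Definition _ n :=
  GRing.isZmodClosed.Build (cocycle n) (@is_coboundary n)
    (@is_coboundary_closed n).

Definition cohomology (n : nat) : zmodType :=
  Quotient.quot (@is_coboundary n : zmodClosed (cocycle n)).

Definition cohomology_class n (z : cocycle n) : cohomology n :=
  (\pi_(Quotient.quot (@is_coboundary n : zmodClosed (cocycle n))) z)%qT.

End Complex.

Section Deformation.
Variables (k : fieldType) (lambda : k) (g h : leibnizType k).
Variables (rho : leibniz_alg_rep g h) (T : {linear h -> g}).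

Definition dbracket (P Q : {linear h -> g}) (u v : h) : g :=
  P (rhoL rho (Q u) v + rhoR rho u (Q v))
  + Q (rhoL rho (P u) v + rhoR rho u (P v))
  - lbr (P u) (Q v) - lbr (Q u) (P v).

Record is_deformation (N : nat) (Ts : 'I_N.+1 -> {linear h -> g}) : Prop := {
  deformation0 : Ts 0 =1 T;
  deformation_rrb : is_rrb (tconst N lambda) (trep N rho) (tmap Ts)
}.

(* T_t^N + t^{N+1} T' *)
Definition extend (N : nat) (Ts : 'I_N.+1 -> {linear h -> g})
    (T' : {linear h -> g}) : 'I_N.+2 -> {linear h -> g} :=
  fun i => if unlift ord_max i is Some j then Ts j else T'.

Definition extensible (N : nat) (Ts : 'I_N.+1 -> {linear h -> g}) : Prop :=
  exists T' : {linear h -> g}, is_deformation (extend Ts T').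

Definition Ob (N : nat) (Ts : 'I_N.+1 -> {linear h -> g}) : cochain g h 2 :=
  fun u => - 2%:R^-1 *:
    \sum_(i < N.+1) \sum_(j < N.+1 | [&& (i + j == N.+1)%N, (0 < i)%N & (0 < j)%N])
      dbracket (Ts i) (Ts j) (u 0) (u 1).

End Deformation.

(* Closes an equation between two sums of the same terms in different orders. *)
Ltac addr_perm :=
  apply: (addIr 0); rewrite -?addrA;
  repeat (match goal with |- ?x + _ = _ =>
    do ? rewrite [in RHS](addrCA _ x); congr (x + _) end).

(* Closes an equation between sums that holds by cancellation of terms. *)
Ltac addr_cancel :=
  apply/eqP; rewrite -subr_eq0 ?(opprD, opprK, oppr0, addr0); apply/eqP;
  rewrite -[LHS]addr0 -?addrA;
  repeat (match goal with
    | |- - ?x + _ = _ => do ? rewrite [in LHS](addrCA _ x); rewrite addNKr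
    | |- ?x + _ = _ => do ? rewrite [in LHS](addrCA _ (- x)); rewrite addKr
    end); done.

Section Bianchi.
Variables (R : comNzRingType) (lambda : R) (g h : leibnizType R).
Variables (rho : leibniz_alg_rep g h) (T : {linear h -> g}).
Notation mu := (brT lambda rho T).
Notation "'L" := (rhoL rho).
Notation "'R" := (rhoR rho).

Definition rrb_defect (u v : h) : g := T (mu u v) - lbr (T u) (T v).

Lemma brT_assoc u v w :
  'L (T u) (mu v w) + lambda *: lbr u (mu v w) + 'R u (lbr (T v) (T w))
  = 'L (T v) (mu u w) + lambda *: lbr v (mu u w) + 'R v (lbr (T u) (T w))
    + ('L (lbr (T u) (T v)) w + 'R (mu u v) (T w) + lambda *: lbr (mu u v) w).
Proof.
rewrite /brT !(linearDr 'L, linearDr (@lbr R h), linearDl 'R, linearDl (@lbr R h)).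
rewrite !(linearZr_LR 'L, linearZr_LR (@lbr R h), linearZl_LR 'R,
          linearZl_LR (@lbr R h)).
rewrite ['L (T u) ('L _ _)]rhoLL ['L (T u) ('R _ _)]rhoLR.
rewrite ['L (T u) (lbr v w)]rhoL_lbr [lbr u ('L _ _)]lbr_rhoL.
rewrite [lbr u ('R _ _)]lbr_rhoR [lbr u (lbr v w)]lbr_leibniz.
rewrite ['R u (lbr _ _)]rhoRR !scalerDr.
addr_perm.
Qed.

Lemma bianchi u v w :
  varrhoL rho T u (rrb_defect v w) - varrhoL rho T v (rrb_defect u w)
  - varrhoR rho T (rrb_defect u v) w - rrb_defect (mu u v) w
  - rrb_defect v (mu u w) + rrb_defect u (mu v w) = 0.
Proof.
have brTE x y : mu x y = 'L (T x) y + 'R x (T y) + lambda *: lbr x y by [].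
have A x y z : varrhoL rho T x (rrb_defect y z) + rrb_defect x (mu y z)
  = T ('L (T x) (mu y z) + lambda *: lbr x (mu y z) + 'R x (lbr (T y) (T z)))
    - lbr (T x) (lbr (T y) (T z)).
  rewrite /varrhoL /rrb_defect (brTE x (mu y z)) (linearBr (@lbr R g)).
  rewrite (linearBr 'R) !(linearD T) (linearN T).
  addr_cancel.
have B x y z : varrhoR rho T (rrb_defect x y) z + rrb_defect (mu x y) z
  = T ('L (lbr (T x) (T y)) z + 'R (mu x y) (T z) + lambda *: lbr (mu x y) z)
    - lbr (lbr (T x) (T y)) (T z).
  rewrite /varrhoR /rrb_defect (brTE (mu x y) z) (linearBl (@lbr R g)).
  rewrite (linearBl 'L) !(linearD T) (linearN T).
  addr_cancel.
transitivity (varrhoL rho T u (rrb_defect v w) + rrb_defect u (mu v w)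
  - (varrhoL rho T v (rrb_defect u w) + rrb_defect v (mu u w))
  - (varrhoR rho T (rrb_defect u v) w + rrb_defect (mu u v) w)).
  addr_cancel.
rewrite !A B brT_assoc lbr_leibniz (linearD T).
addr_cancel.
Qed.

End Bianchi.

Section SeriesDefect.
Variables (N : nat) (R : comNzRingType) (lambda : R) (g h : leibnizType R).
Variables (rho : leibniz_alg_rep g h).

Lemma cauchy_const_r (V : zmodType) (F : 'I_N.+1 -> 'I_N.+1 -> V) n :
  (forall i j, j != 0 -> F i j = 0) -> cauchy F n = F n 0.
Proof. by move=> F0; rewrite cauchyC cauchy_const_l // => i j; apply: F0. Qed.

Lemma tmap_const (Ts : 'I_N.+1 -> {linear h -> g}) a n :
  tmap Ts (tconst N a) n = Ts n a.
Proof.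
rewrite cauchy_const_r ?ffunE // => i j /negPf j0.
by rewrite ffunE j0 linear0.
Qed.

Section Coef.
Variable Ts : 'I_N.+1 -> {linear h -> g}.

Definition defect_coef (i j : 'I_N.+1) (a b : h) : g :=
  Ts i (rhoL rho (Ts j a) b + rhoR rho a (Ts j b)
        + (if j == 0 then lambda *: lbr a b else 0))
  - lbr (Ts i a) (Ts j b).

Lemma tser_const_lbr (a b : h) :
  lbr (tconst N a) (tconst N b) = tconst N (lbr a b).
Proof.
apply/ffunP => n; rewrite tser_lbrE cauchy_const_l => [|i j /negPf i0].
  by rewrite !ffunE eqxx; case: ifP => // _; rewrite linear0r.
by rewrite ffunE i0 linear0l.
Qed.

Lemma tser_const_scale (a : R) (v : h) :
  tconst N a *: tconst N v = tconst N (a *: v).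
Proof.
apply/ffunP => n; rewrite tser_scaleE cauchy_const_l => [|i j /negPf i0].
  by rewrite !ffunE eqxx; case: ifP => // _; rewrite scaler0.
by rewrite ffunE i0 scale0r.
Qed.

Lemma defect_const a b :
  rrb_defect (tconst N lambda) (trep N rho) (tmap Ts) (tconst N a) (tconst N b)
  = cauchy (fun i j => defect_coef i j a b).
Proof.
rewrite /rrb_defect /brT tser_const_lbr tser_const_scale tser_lbrE.
rewrite /defect_coef; apply/ffunP => n.
rewrite ffunE [X in _ + X]ffunE !ffunE -sumrB; apply: eq_bigr => i _.
rewrite -sumrB; apply: eq_bigr => j _.
rewrite !tmap_const; congr (Ts i _ - _).
rewrite ffunE [X in X + _]ffunE; congr (_ + _ + _); last by rewrite ffunE.
  rewrite [LHS]cauchy_const_r => [|i' j' /negPf j0].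
    by rewrite tmap_const ffunE.
  by rewrite [X in rhoL _ _ X]ffunE j0 linear0r.
rewrite [LHS]cauchy_const_l => [|i' j' /negPf i0].
  by rewrite tmap_const ffunE.
by rewrite [X in rhoR _ X _]ffunE i0 linear0l.
Qed.

End Coef.

Definition tmon (i : 'I_N.+1) : tser N R := [ffun j => (j == i)%:R].

Section Monomial.
Variable V : lmodType R.

Lemma tmon_coef i (x : tser N V) n :
  (tmon i *: x) n = \sum_(j < N.+1 | (i + j == n)%N) x j.
Proof.
rewrite tser_scaleE ffunE (bigD1 i) //= [X in _ + X]big1 ?addr0 => [|l /negPf li].
  by apply: eq_bigr => j _; rewrite ffunE eqxx scale1r.
by rewrite big1 // => j _; rewrite ffunE li scale0r.
Qed.

Lemma tmon_max (x : tser N V) n :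
  (tmon ord_max *: x) n = if n == ord_max then x 0 else 0.
Proof.
rewrite tmon_coef; case: eqP => [->|/eqP nm].
  by rewrite (big_pred1 0) // => j; rewrite -[X in _ == X]addn0 eqn_add2l.
rewrite big1 // => j /eqP e; case/eqP: nm; apply/val_inj/eqP => /=.
by rewrite eqn_leq -{1}ltnS ltn_ord -e leq_addr.
Qed.

Lemma tmon_mon_max i (x : tser N V) : i != 0 -> tmon i *: (tmon ord_max *: x) = 0.
Proof.
move=> i0; apply/ffunP => n; rewrite tmon_coef ffunE big1 // => j /eqP e.
rewrite tmon_max; case: eqP => // jm.
have : (i + j <= N)%N by rewrite e -ltnS.
rewrite jm /= -[X in (_ <= X)%N]add0n leq_add2r leqn0 => /eqP iz.
by case/eqP: i0; apply/val_inj.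
Qed.

Lemma tser_decomp (x : tser N V) : x = \sum_i tmon i *: tconst N (x i).
Proof.
apply/ffunP => n; rewrite sum_ffunE (bigD1 n) //= big1 ?addr0 => [|i ni].
  by rewrite tmon_coef (big_pred1 0) ?ffunE // => j; rewrite -[X in _ == X]addn0 eqn_add2l.
rewrite tmon_coef big1 // => j /eqP e; rewrite ffunE; case: eqP => // j0.
by case/eqP: ni; apply/val_inj; move: e; rewrite j0 /= addn0.
Qed.

End Monomial.
End SeriesDefect.

Section DefectBilinear.
Variables (R : comNzRingType) (lambda : R) (g h : leibnizType R).
Variables (rho : leibniz_alg_rep g h) (T : {linear h -> g}).

Lemma brT_linearl a x y v :
  brT lambda rho T (a *: x + y) v
  = a *: brT lambda rho T x v + brT lambda rho T y v.
Proof.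
rewrite /brT (linearP T).
rewrite (linearDl (rhoL rho)) (linearDl (rhoR rho)) (linearDl (@lbr R h)).
rewrite (linearZl_LR (rhoL rho)) (linearZl_LR (rhoR rho)).
rewrite (linearZl_LR (@lbr R h)) (scalerDr lambda) !(scalerDr a) !scalerA.
rewrite [lambda * a]mulrC.
addr_perm.
Qed.

Lemma brT_linearr u a x y :
  brT lambda rho T u (a *: x + y)
  = a *: brT lambda rho T u x + brT lambda rho T u y.
Proof.
rewrite /brT (linearP T).
rewrite (linearDr (rhoL rho)) (linearDr (rhoR rho)) (linearDr (@lbr R h)).
rewrite (linearZr_LR (rhoL rho)) (linearZr_LR (rhoR rho)).
rewrite (linearZr_LR (@lbr R h)) (scalerDr lambda) !(scalerDr a) !scalerA.
rewrite [lambda * a]mulrC.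
addr_perm.
Qed.

Lemma rrb_defect_linearl a x y v :
  rrb_defect lambda rho T (a *: x + y) v
  = a *: rrb_defect lambda rho T x v + rrb_defect lambda rho T y v.
Proof.
rewrite /rrb_defect brT_linearl !(linearP T) (linearDl (@lbr R g)).
by rewrite (linearZl_LR (@lbr R g)) scalerBr opprD addrACA.
Qed.

Lemma rrb_defect_linearr u a x y :
  rrb_defect lambda rho T u (a *: x + y)
  = a *: rrb_defect lambda rho T u x + rrb_defect lambda rho T u y.
Proof.
rewrite /rrb_defect brT_linearr !(linearP T) (linearDr (@lbr R g)).
by rewrite (linearZr_LR (@lbr R g)) scalerBr opprD addrACA.
Qed.

Lemma rrb_defect_bilinear : bilinear_for *:%R *:%R (rrb_defect lambda rho T).
Proof.
split=> [v a x y|u a x y]; first exact: rrb_defect_linearl.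
exact: rrb_defect_linearr.
Qed.

HB.instance Definition _ :=
  bilinear_isBilinear.Build R h h g *:%R *:%R (rrb_defect lambda rho T)
    rrb_defect_bilinear.

Lemma varrhoLZ u a x : varrhoL rho T u (a *: x) = a *: varrhoL rho T u x.
Proof. by rewrite /varrhoL linearZr_LR (linearZr_LR (rhoR rho)) linearZ scalerBr. Qed.

Lemma varrhoRZ u a x : varrhoR rho T (a *: x) u = a *: varrhoR rho T x u.
Proof. by rewrite /varrhoR linearZl_LR (linearZl_LR (rhoL rho)) linearZ scalerBr. Qed.

Lemma deltaZ n (f : cochain g h n) (a : R) :
  delta lambda rho T (fun u => a *: f u) = fun u => a *: delta lambda rho T f u.
Proof.
apply/funext => u; rewrite /delta [RHS]scalerDr [X in _ = X + _]scalerDr !scaler_sumr; congr (_ + _ + _).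
- by apply: eq_bigr => i _; rewrite varrhoLZ !scalerA mulrC.
- by rewrite varrhoRZ !scalerA mulrC.
- apply: eq_bigr => i _; rewrite scaler_sumr; apply: eq_bigr => j _.
  by rewrite !scalerA mulrC.
Qed.

Lemma delta2E (b : h -> h -> g) (u : {ffun 'I_3 -> h}) :
  delta lambda rho T (fun v : {ffun 'I_2 -> h} => b (v 0) (v 1)) u
  = varrhoL rho T (u 0) (b (u 1) (u 2%:R))
    - varrhoL rho T (u 1) (b (u 0) (u 2%:R))
    - varrhoR rho T (b (u 0) (u 1)) (u 2%:R)
    - b (brT lambda rho T (u 0) (u 1)) (u 2%:R)
    - b (u 1) (brT lambda rho T (u 0) (u 2%:R))
    + b (u 0) (brT lambda rho T (u 1) (u 2%:R)).
Proof.
have e0 : widen_ord (leqnSn 2) 0 = 0 by apply/val_inj.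
have e1 : widen_ord (leqnSn 2) 1 = 1 by apply/val_inj.
have e2 : ord_max = 2%:R :> 'I_3 by apply/val_inj.
have l00 : lift (0 : 'I_3) (0 : 'I_2) = 1 by apply/val_inj.
have l01 : lift (0 : 'I_3) (1 : 'I_2) = 2%:R by apply/val_inj.
have l10 : lift (1 : 'I_3) (0 : 'I_2) = 0 by apply/val_inj.
have l11 : lift (1 : 'I_3) (1 : 'I_2) = 2%:R by apply/val_inj.
have l20 : lift (2%:R : 'I_3) (0 : 'I_2) = 0 by apply/val_inj.
have l21 : lift (2%:R : 'I_3) (1 : 'I_2) = 1 by apply/val_inj.
have s2 (F : 'I_2 -> g) : \sum_i F i = F 0 + F 1.
  rewrite big_ord_recl big_ord1; congr (_ + F _); exact/val_inj.
have s3 (P : pred 'I_3) (F : 'I_3 -> g) : \sum_(i | P i) F i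
    = (if P 0 then F 0 else 0) + ((if P 1 then F 1 else 0)
       + (if P 2%:R then F 2%:R else 0)).
  rewrite big_mkcond big_ord_recl big_ord_recl big_ord1.
  by congr (_ + ((if P _ then F _ else _) + (if P _ then F _ else _)));
    apply/val_inj.
rewrite /delta s2 !s3 /= e0 e1 e2 !ffunE !(l00, l01, l10, l11, l20, l21) /=.
have sE m : (-1) ^+ m = (if odd m then -1 else 1) :> R.
  by rewrite -signr_odd; case: (odd m).
by rewrite !add0r !addr0 !sE /= !scaleN1r !scale1r !addrA.
Qed.

End DefectBilinear.

Section ObstructionCocycle.
Variables (k : fieldType) (lambda : k) (g h : leibnizType k).
Variables (rho : leibniz_alg_rep g h) (T : {linear h -> g}) (N : nat).
Variable Ts : 'I_N.+1 -> {linear h -> g}.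
Hypothesis defT : is_deformation lambda rho T Ts.

Let Te : 'I_N.+2 -> {linear h -> g} := extend Ts \0.

Let obsum (a b : h) : g :=
  \sum_(i < N.+1) \sum_(j < N.+1 | [&& (i + j == N.+1)%N, (0 < i)%N & (0 < j)%N])
    (Ts i (rhoL rho (Ts j a) b + rhoR rho a (Ts j b)) - lbr (Ts i a) (Ts j b)).

Lemma extend_widen T' i : extend Ts T' (widen_ord (leqnSn _) i) = Ts i.
Proof.
rewrite /extend; have -> : widen_ord (leqnSn N.+1) i = lift ord_max i.
  by apply/val_inj; rewrite /= /bump leqNgt ltn_ord.
by rewrite liftK.
Qed.

Lemma extend_max T' : extend Ts T' ord_max = T'.
Proof. by rewrite /extend unlift_none. Qed.

Lemma defect_extend a b :
  rrb_defect (tconst N.+1 lambda) (trep N.+1 rho) (tmap Te)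
    (tconst N.+1 a) (tconst N.+1 b)
  = tmon k ord_max *: tconst N.+1 (obsum a b).
Proof.
rewrite defect_const; apply/ffunP => n; rewrite tmon_max [LHS]ffunE.
have -> : \sum_(i < N.+2) \sum_(j < N.+2 | (i + j == n)%N)
    defect_coef lambda rho Te i j a b
  = \sum_(i < N.+1) \sum_(j < N.+1 | (i + j == n)%N)
    defect_coef lambda rho Ts i j a b.
  rewrite big_ord_recr /= [X in _ + X]big1 ?addr0 => [|j _]; last first.
    by rewrite /defect_coef /Te extend_max /= linear0l subr0.
  apply: eq_bigr => i _; rewrite big_mkcond big_ord_recr /= -big_mkcond /=.
  rewrite [X in _ + X](_ : _ = 0) ?addr0; last first.
    case: ifP => // _; rewrite /defect_coef /Te extend_max extend_widen /=.
    by rewrite linear0l linear0r !addr0 linear0 linear0r subr0.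
  by apply: eq_bigr => j _; rewrite /defect_coef /Te !extend_widen.
case: (eqVneq n ord_max) => [->|nm].
  rewrite ffunE /=; apply: eq_bigr => i _.
  rewrite (eq_bigl (fun j : 'I_N.+1 =>
      [&& (i + j == N.+1)%N, (0 < i)%N & (0 < j)%N])) => [|j].
    apply: eq_bigr => j /and3P[_ _ j0].
    rewrite /defect_coef; case: eqP => [jz|_]; last by rewrite addr0.
    by rewrite jz in j0.
  case: eqP => //= e; rewrite !lt0n; symmetry; apply/andP; split; apply/eqP => z.
    by move: e (ltn_ord j); rewrite z add0n => ->; rewrite ltnn.
  by move: e (ltn_ord i); rewrite z addn0 => ->; rewrite ltnn.
have nN : (n < N.+1)%N.
  by have := ltn_ord n; rewrite ltnS leq_eqVlt (negPf (nm : val n != N.+1)).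
have := deformation_rrb defT (tconst N a) (tconst N b) => /esym/eqP.
rewrite -subr_eq0 => /eqP/(etrans (esym (defect_const _ _ _ _ _))).
by move/ffunP/(_ (Ordinal nN)); rewrite !ffunE.
Qed.

Let K := rrb_defect (tconst N.+1 lambda) (trep N.+1 rho) (tmap Te).

Lemma defect_extendE x y :
  K x y = tmon k ord_max *: tconst N.+1 (obsum (x 0) (y 0)).
Proof.
have KZl a x' y' : K (a *: x') y' = a *: K x' y' by exact: linearZl_LR.
have KZr a x' y' : K x' (a *: y') = a *: K x' y' by exact: linearZr_LR.
have Ksl (F : 'I_N.+2 -> tser N.+1 h) y' :
  K (\sum_i F i) y' = \sum_i K (F i) y' by exact: linear_sumlz.
have Ksr (F : 'I_N.+2 -> tser N.+1 h) x' :
  K x' (\sum_i F i) = \sum_i K x' (F i) by exact: linear_sumr.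
have m0 : tmon k 0 = 1 :> tser N.+1 k.
  by apply/ffunP => j; rewrite tser_oneE !ffunE; case: eqP.
rewrite {1}(tser_decomp x) {1}(tser_decomp y) Ksl (bigD1 0) //=.
rewrite [X in _ + X]big1 ?addr0 => [|i i0]; last first.
  rewrite KZl Ksr scaler_sumr big1 // => j _.
  rewrite KZr /K defect_extend scalerA mulrC -scalerA.
  by rewrite tmon_mon_max // scaler0.
rewrite KZl m0 scale1r Ksr (bigD1 0) //= big1 ?addr0 => [|j j0].
  by rewrite KZr m0 scale1r /K defect_extend.
by rewrite KZr /K defect_extend tmon_mon_max.
Qed.

Lemma delta_obsum :
  delta lambda rho T (fun v : {ffun 'I_2 -> h} => obsum (v 0) (v 1)) = 0.
Proof.
apply/funext => u; rewrite delta2E -[RHS]/(0 : g).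
move: (u 0) (u 1) (u 2%:R) => {u} a b c.
have := bianchi (tconst N.+1 lambda) (trep N.+1 rho) (tmap Te)
  (tconst N.+1 a) (tconst N.+1 b) (tconst N.+1 c).
rewrite -/K !defect_extendE !varrhoLZ !varrhoRZ -!scalerN -!scalerDr.
move/ffunP/(_ ord_max); rewrite tmon_max eqxx.
have T0 x : (tmap Te x) 0 = T (x 0).
  rewrite cauchy0 /Te -(deformation0 defT); congr (_ _).
  by rewrite (_ : 0 = widen_ord (leqnSn N.+1) 0) ?extend_widen //; apply/val_inj.
have rL0 x y : rhoL (trep N.+1 rho) x y 0 = rhoL rho (x 0) (y 0).
  exact: cauchy0.
have rR0 x y : rhoR (trep N.+1 rho) x y 0 = rhoR rho (x 0) (y 0).
  exact: cauchy0.
have lh0 (x y : tser N.+1 h) : lbr x y 0 = lbr (x 0) (y 0) by exact: cauchy0.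
have lg0 (x y : tser N.+1 g) : lbr x y 0 = lbr (x 0) (y 0) by exact: cauchy0.
have sc0 (s : tser N.+1 k) (x : tser N.+1 h) : (s *: x) 0 = s 0 *: x 0.
  exact: cauchy0.
have cst (V : zmodType) (x : V) : tconst N.+1 x 0 = x by rewrite ffunE.
have br0 x y : brT (tconst N.+1 lambda) (trep N.+1 rho) (tmap Te) x y 0
    = brT lambda rho T (x 0) (y 0).
  by rewrite /brT ffunE [X in X + _]ffunE sc0 rL0 rR0 lh0 !T0 cst.
have addE (x y : tser N.+1 g) : (x + y) 0 = x 0 + y 0 by rewrite ffunE.
have oppE (x : tser N.+1 g) : (- x) 0 = - x 0 by rewrite ffunE.
have zE : (0 : tser N.+1 g) ord_max = 0 by rewrite ffunE.
by rewrite !(addE, oppE) !(lg0, T0, rR0, rL0, cst, br0) zE.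
Qed.

Lemma ObE : Ob rho Ts = fun u => - 2%:R^-1 *: (obsum (u 0) (u 1) + obsum (u 0) (u 1)).
Proof.
apply/funext => u; rewrite /Ob; congr (_ *: _).
rewrite /obsum [X in _ = _ + X](exchange_big_dep xpredT) //= -big_split /=.
apply: eq_bigr => i _.
rewrite [X in _ = _ + X](eq_bigl (fun j : 'I_N.+1 =>
    [&& (i + j == N.+1)%N, (0 < i)%N & (0 < j)%N])) => [|j]; last first.
  by rewrite /= addnC; congr (_ && _); rewrite andbC.
rewrite -big_split /=; apply: eq_bigr => j _; rewrite /dbracket.
by rewrite -[LHS]addrA -opprD addrACA -opprD.
Qed.

Lemma obsum_linearl a x y v : obsum (a *: x + y) v = a *: obsum x v + obsum y v.
Proof.
rewrite /obsum scaler_sumr -big_split; apply: eq_bigr => i _.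
rewrite scaler_sumr -big_split; apply: eq_bigr => j _ /=.
rewrite !(linearP (Ts _)) (linearDl (rhoL rho)) (linearZl_LR (rhoL rho)).
rewrite (linearDl (rhoR rho)) (linearZl_LR (rhoR rho)).
rewrite (linearDl (@lbr k g)) (linearZl_LR (@lbr k g)).
rewrite addrACA -(scalerDr a) linearP.
by rewrite scalerBr opprD addrACA.
Qed.

Lemma obsum_linearr v a x y : obsum v (a *: x + y) = a *: obsum v x + obsum v y.
Proof.
rewrite /obsum scaler_sumr -big_split; apply: eq_bigr => i _.
rewrite scaler_sumr -big_split; apply: eq_bigr => j _ /=.
rewrite !(linearP (Ts _)) (linearDr (rhoL rho)) (linearZr_LR (rhoL rho)).
rewrite (linearDr (rhoR rho)) (linearZr_LR (rhoR rho)).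
rewrite (linearDr (@lbr k g)) (linearZr_LR (@lbr k g)).
rewrite addrACA -(scalerDr a) linearP.
by rewrite scalerBr opprD addrACA.
Qed.

Lemma Ob_multilinear : multilinear (Ob rho Ts).
Proof.
move=> u i a x y; rewrite ObE /=.
have -> : obsum (subst u i (a *: x + y) 0) (subst u i (a *: x + y) 1)
  = a *: obsum (subst u i x 0) (subst u i x 1)
    + obsum (subst u i y 0) (subst u i y 1).
  case: (unliftP 0 i) => [i'|] ->; rewrite ?ord1 !ffunE /=.
    by rewrite obsum_linearr.
  by rewrite obsum_linearl.
rewrite [X in _ *: X = _]addrACA -(scalerDr a) [LHS]scalerDr; congr (_ + _).
by rewrite !scalerA mulrC.
Qed.

Lemma Ob_cocycle : Ob rho Ts \in @is_cocycle k lambda g h rho T 2.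
Proof.
apply/asboolP; split; first exact: Ob_multilinear.
rewrite ObE deltaZ; apply/funext => u.
have -> : (fun v : {ffun 'I_2 -> h} => obsum (v 0) (v 1) + obsum (v 0) (v 1))
  = ((fun v => obsum (v 0) (v 1)) : cochain g h 2)
    + (fun v => obsum (v 0) (v 1)) by [].
by rewrite deltaD delta_obsum addr0 scaler0.
Qed.

Definition obstruction_class : cohomology lambda rho T 2 :=
  cohomology_class (Cocycle Ob_cocycle).

End ObstructionCocycle.

(* Main.v *)
Require Import Defs.
From HB Require Import structures.
From mathcomp Require Import all_boot all_algebra.
From mathcomp Require Import boolp functions.

Set Implicit Arguments.
Unset Strict Implicit.
Unset Printing Implicit Defensive.

Import GRing.Theory.
Local Open Scope ring_scope.

(** The Rota-Baxter defect of a map S is S [u, v]_S - [S u, S v]; it vanishes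
    exactly when S is a weighted relative Rota-Baxter operator.  For a
    truncated series it is bilinear over the truncated power series, so it
    vanishes as soon as it vanishes on constant arguments, and there it can be
    computed coefficient by coefficient ([is_rrb_tmap]).

    Extend the order N deformation by a top coefficient T'.  Coefficients of
    t^n with n <= N of the defect do not see T' and vanish by hypothesis.  In
    the coefficient of t^(N+1), T' can only be paired with T, so it enters
    affinely ([cauchy_defect_extend]): the pairs (i, j) with i, j >= 1 give a
    fixed cochain [obstruction], and the terms T' [u, v]_T - [T' u, T v] and
    T (T' u . v + u . T' v) - [T u, T' v] add up to minus the coboundary of T'.
    Hence T' extends the deformation if and only if
      obstruction = delta T'      ([is_deformation_extend]).

    The double bracket is symmetric in its two maps, so the sum defining Ob
    counts each term of [obstruction] twice; once 2 is invertible, Ob is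
    exactly - [obstruction] ([Ob_obstruction]).  Therefore solving the equation
    above for a linear T' amounts to writing Ob as a coboundary, which is the
    vanishing of its class ([cohomology_class_eq0]). *)

(** * Low-degree cohomology *)

Section Cohomology.
Variables (R : comNzRingType) (lambda : R) (g h : leibnizType R).
Variables (rho : leibniz_alg_rep g h) (T : {linear h -> g}).

Lemma cohomology_class_eq0 n (z : cocycle lambda rho T n) :
  cohomology_class z = 0 <-> coboundary lambda rho T (z : cochain g h n).
Proof.
have zE : cohomology_class z = 0 <-> z \in @is_coboundary R lambda g h rho T n.
  rewrite -[X in X \in _]subr0 Quotient.idealrBE /cohomology_class.
  rewrite [\pi_(Quotient.quot _)%qT 0](raddf0 _).
  by split=> /eqP.
by rewrite zE; split=> /asboolP.
Qed.

(** This is the shape in which the contribution of a top coefficient to the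
    Rota-Baxter equation shows up. *)
Lemma delta1E (f : h -> g) (u : {ffun 'I_2 -> h}) :
  delta lambda rho T (fun v : {ffun 'I_1 -> h} => f (v 0)) u
  = varrhoL rho T (u 0) (f (u 1)) + varrhoR rho T (f (u 0)) (u 1)
    - f (brT lambda rho T (u 0) (u 1)).
Proof.
have e0 : widen_ord (leqnSn 1) 0 = 0 by apply/val_inj.
have e1 : ord_max = 1 :> 'I_2 by apply/val_inj.
have l00 : lift (0 : 'I_2) (0 : 'I_1) = 1 by apply/val_inj.
have l10 : lift (1 : 'I_2) (0 : 'I_1) = 0 by apply/val_inj.
have s2 (P : pred 'I_2) (F : 'I_2 -> g) : \sum_(i | P i) F i
    = (if P 0 then F 0 else 0) + (if P 1 then F 1 else 0).
  rewrite big_mkcond big_ord_recl big_ord1.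
  by congr (_ + (if P _ then F _ else _)); apply/val_inj.
rewrite /delta big_ord1 !s2 /= e0 e1 !ffunE !(l00, l10) /=.
by rewrite !add0r !addr0 expr1 expr0 scaleN1r scale1r expr2 mulrNN mulr1 scale1r.
Qed.

End Cohomology.

Section OneCochains.
Variables (R : comNzRingType) (g h : leibnizType R).

Lemma multilinear1_linear (b : cochain g h 1) : multilinear b ->
  exists f : {linear h -> g}, b = fun u => f (u 0).
Proof.
move=> mb; pose f x := b [ffun => x].
have lf : linear f.
  move=> a x y; have := mb [ffun => 0] 0 a x y.
  have subE z : subst [ffun => 0] 0 z = [ffun => z] :> {ffun 'I_1 -> h}.
    by apply/ffunP => i; rewrite !ffunE ord1.
  by rewrite !subE.
pose F := GRing.isLinear.Build R h g *:%R f lf.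
pose f' : {linear h -> g} := HB.pack f F.
exists f'; apply/funext => u; rewrite /= /f; congr b.
by apply/ffunP => i; rewrite !ffunE ord1.
Qed.

Lemma linear_multilinear1 (f : {linear h -> g}) :
  multilinear ((fun u => f (u 0)) : cochain g h 1).
Proof. by move=> u i a x y; rewrite !ffunE !ord1 eqxx linearP. Qed.

End OneCochains.

(** * The defect of an extended deformation *)

(** Meant for [D] the change in a product of series when only last coefficients
    change: on the border i = N+1 or j = N+1 of the square, the only pairs with
    i + j <= N+1 are (N+1, 0) and (0, N+1). *)
Lemma cauchy_border N (V : zmodType) (D : 'I_N.+2 -> 'I_N.+2 -> V) n :
  (forall i j, i != ord_max -> j != ord_max -> D i j = 0) ->
  cauchy D n = if n == ord_max then D ord_max 0 + D 0 ord_max else 0.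
Proof.
move=> D0.
have row0 i : i != ord_max -> \sum_(j < N.+2 | (i + j == n)%N) D i j
    = if (n == ord_max) && (i == 0) then D i ord_max else 0.
  move=> im; rewrite big_mkcond (bigD1 ord_max) //= big1 ?addr0 => [|j jm].
    congr (if _ then _ else _); apply/eqP/andP => [e|[/eqP-> /eqP->]] //.
    have i0 : (i : nat) = 0%N.
      have := ltn_ord n.
      by rewrite -e -addSn ltnS -[X in (_ <= X)%N]add0n leq_add2r leqn0 => /eqP.
    by split; apply/eqP/val_inj; rewrite //= -e i0.
  by rewrite D0 // if_same.
rewrite ffunE (bigD1 ord_max) //= (eq_bigr _ row0).
case: (eqVneq n ord_max) => [->|nm] /=.
  rewrite (big_pred1 0) => [|j]; last by rewrite -[X in _ == X]addn0 eqn_add2l.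
  congr (_ + _); rewrite (bigD1 0) //= big1 ?addr0 // => i.
  by move=> /andP[_ /negPf->].
rewrite !big1 ?addr0 // => j /eqP e; case/eqP: nm; apply/val_inj/eqP => /=.
by rewrite eqn_leq -{1}ltnS ltn_ord -e leq_addr.
Qed.

Section Deformation.
Variables (k : fieldType) (lambda : k) (g h : leibnizType k).
Variables (rho : leibniz_alg_rep g h).

(** The monomials t^i times constants span the series, and the defect is
    bilinear over the ring of truncated power series; this reduces the operator
    identity to identities between its coefficients on constants. *)
Lemma is_rrb_tmap N (Ts : 'I_N.+1 -> {linear h -> g}) :
  is_rrb (tconst N lambda) (trep N rho) (tmap Ts) <->
  forall a b, cauchy (fun i j => defect_coef lambda rho Ts i j a b) = 0.
Proof.
pose K := rrb_defect (tconst N lambda) (trep N rho) (tmap Ts).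
have KZl a x y : K (a *: x) y = a *: K x y by exact: linearZl_LR.
have KZr a x y : K x (a *: y) = a *: K x y by exact: linearZr_LR.
have Ksl (F : 'I_N.+1 -> tser N h) y :
  K (\sum_i F i) y = \sum_i K (F i) y by exact: linear_sumlz.
have Ksr (F : 'I_N.+1 -> tser N h) x :
  K x (\sum_i F i) = \sum_i K x (F i) by exact: linear_sumr.
split=> [rrbTs a b|K0 x y].
  by rewrite -defect_const /rrb_defect rrbTs subrr.
apply/esym/subr0_eq; rewrite -[LHS]/(K x y) (tser_decomp x) (tser_decomp y) Ksl.
rewrite big1 // => i _; rewrite KZl Ksr big1 ?scaler0 // => j _.
by rewrite KZr /K defect_const K0 scaler0.
Qed.

Variables (N : nat) (Ts : 'I_N.+1 -> {linear h -> g}).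

(** The zero map as top coefficient serves as base point, so that what is left
    is the part of the defect that depends on [T']. *)
Lemma cauchy_defect_extend T' a b (n : 'I_N.+2) :
  cauchy (fun i j => defect_coef lambda rho (extend Ts T') i j a b) n =
  cauchy (fun i j => defect_coef lambda rho (extend Ts \0) i j a b) n +
  (if n == ord_max then
     T' (brT lambda rho (Ts 0) a b) - lbr (T' a) (Ts 0 b)
     + (Ts 0 (rhoL rho (T' a) b + rhoR rho a (T' b)) - lbr (Ts 0 a) (T' b))
   else 0).
Proof.
pose D i j := defect_coef lambda rho (extend Ts T') i j a b
              - defect_coef lambda rho (extend Ts \0) i j a b.
have widen0 : 0 = widen_ord (leqnSn N.+1) 0 :> 'I_N.+2 by apply/val_inj.
have ext0 U : extend Ts U 0 = Ts 0 by rewrite [in LHS]widen0 extend_widen.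
have D0 i j : i != ord_max -> j != ord_max -> D i j = 0.
  move=> im jm; rewrite /D /defect_coef /extend.
  case: (unliftP ord_max i) im => [i' _|->]; last by rewrite eqxx.
  case: (unliftP ord_max j) jm => [j' _|->]; last by rewrite eqxx.
  by rewrite subrr.
have Dl : D ord_max 0 = T' (brT lambda rho (Ts 0) a b) - lbr (T' a) (Ts 0 b).
  by rewrite /D /defect_coef !extend_max !ext0 eqxx /= linear0l subr0 subr0.
have Dr : D 0 ord_max =
    Ts 0 (rhoL rho (T' a) b + rhoR rho a (T' b)) - lbr (Ts 0 a) (T' b).
  rewrite /D /defect_coef !extend_max !ext0 /= !addr0.
  by rewrite linear0l !linear0r addr0 linear0 subr0 subr0.
have cD : cauchy D n = if n == ord_max then D ord_max 0 + D 0 ord_max else 0.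
  exact: cauchy_border.
have -> : cauchy (fun i j => defect_coef lambda rho (extend Ts T') i j a b)
    = cauchy (fun i j => defect_coef lambda rho (extend Ts \0) i j a b) + cauchy D.
  by rewrite -cauchyD; apply: eq_cauchy => i j; rewrite addrC subrK.
by rewrite -Dl -Dr -cD ffunE.
Qed.

Variables (T : {linear h -> g}) (defT : is_deformation lambda rho T Ts).

(** One half of the sum of the double brackets of [Ts i] and [Ts j]: only the
    terms in which [Ts i] is applied last, as they occur in the defect. *)
Definition obstruction_coef (a b : h) : g :=
  \sum_(i < N.+1) \sum_(j < N.+1 | [&& (i + j == N.+1)%N, (0 < i)%N & (0 < j)%N])
    (Ts i (rhoL rho (Ts j a) b + rhoR rho a (Ts j b)) - lbr (Ts i a) (Ts j b)).

Definition obstruction : cochain g h 2 := fun u => obstruction_coef (u 0) (u 1).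

(** Below degree N+1 the equations are those already solved by [Ts]; the one
    in degree N+1 says that [T'] is a primitive of the obstruction. *)
Lemma is_deformation_extend T' :
  is_deformation lambda rho T (extend Ts T') <->
  obstruction = delta lambda rho T (fun u : {ffun 'I_1 -> h} => T' (u 0)).
Proof.
have T0 : Ts 0 =1 T := deformation0 defT.
have ext0 : extend Ts T' 0 =1 T.
  have -> : 0 = widen_ord (leqnSn N.+1) 0 :> 'I_N.+2 by apply/val_inj.
  by move=> x; rewrite extend_widen T0.
have coefE a b n : cauchy (fun i j => defect_coef lambda rho (extend Ts T') i j a b) n
    = if n == ord_max then obstruction_coef a b -
        (varrhoL rho T a (T' b) + varrhoR rho T (T' a) b - T' (brT lambda rho T a b))
      else 0.
  rewrite cauchy_defect_extend -defect_const (defect_extend defT) tmon_max.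
  rewrite ffunE eqxx -/(obstruction_coef a b); case: eqP => // _; last by rewrite addr0.
  rewrite /varrhoL /varrhoR /brT !T0 (linearD T).
  addr_cancel.
split=> [[_ /is_rrb_tmap rrbTs]|eq_ob].
  apply/funext => u; rewrite delta1E /obstruction.
  have /ffunP/(_ ord_max) := rrbTs (u 0) (u 1).
  by rewrite coefE eqxx ffunE => /subr0_eq.
split=> //; apply/is_rrb_tmap => a b; apply/ffunP => n; rewrite coefE ffunE.
have := congr1 (@^~ [ffun i : 'I_2 => if i == 0 then a else b]) eq_ob.
by rewrite /= delta1E /obstruction !ffunE => ->; rewrite subrr if_same.
Qed.

(** Symmetrizing the sum over (i, j) doubles it, which the factor 1/2 undoes. *)
Lemma Ob_obstruction : (2%:R : k) != 0 -> Ob rho Ts = - obstruction.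
Proof.
move=> nz2; rewrite ObE; apply/funext => u.
rewrite -/(obstruction_coef (u 0) (u 1)) -mulr2n -scaler_nat scalerA mulNr mulVf //.
by rewrite scaleN1r.
Qed.

End Deformation.

(** * Extensibility *)

Theorem theorem5p11 (k : fieldType) (char0 : [pchar k] =i pred0) (lambda : k)
    (g h : leibnizType k) (rho : leibniz_alg_rep g h)
    (T : {linear h -> g}) (rrbT : is_rrb lambda rho T)
    (N : nat) (Ts : 'I_N.+1 -> {linear h -> g})
    (defT : is_deformation lambda rho T Ts) :
  extensible lambda rho T Ts <-> obstruction_class defT = 0.
Proof.
have nz2 : (2%:R : k) != 0 by rewrite ((pcharf0P k).1 char0).
rewrite cohomology_class_eq0 /= (Ob_obstruction rho Ts nz2).
(* Ob = - obstruction, so primitives change sign in both directions. *)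
split=> [[T' /(is_deformation_extend defT) ->]|[b mb /(congr1 -%R)]].
  exists (0 - (fun u => T' (u 0))); last by rewrite deltaB delta0 sub0r.
  by apply: multilinearB; [exact: multilinear0 | exact: linear_multilinear1].
rewrite opprK -[- _]add0r -(delta0 lambda rho T) -deltaB => obE.
have [f bE] := multilinear1_linear (multilinearB (@multilinear0 _ _ _ _) mb).
by exists f; apply/(is_deformation_extend defT); rewrite obE bE.
Qed.
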